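(* Let $L_0$, $L_1$, $L_2$ be lattices and let $\eta_1\colon L_0\to L_1$ and $\eta_2\colon L_0\to L_2$ be lattice homomorphisms. Let $D$ be a finite distributive lattice, and, for $i\in\{1,2\}$, let $\psi_i\colon \operatorname{Con} L_i\to D$ be complete $\bigvee$-homomorphisms such that $$\psi_1\circ\operatorname{Con}\eta_1 = \psi_2\circ\operatorname{Con}\eta_2.$$ Then there is a lattice $L$, there are lattice homomorphisms $\varphi_i\colon L_i\to L$, for $i\in\{1,2\}$, with $$\varphi_1\circ\eta_1=\varphi_2\circ\eta_2,$$ and there is an isomorphism $\alpha\colon\operatorname{Con} L\to D$ such that $$\alpha\circ\operatorname{Con}\varphi_i = \psi_i \quad\text{for } i\in\{1,2\}.$$ If $L_0$, $L_1$, $L_2$ have zero and both $\eta_1$, $\eta_2$ preserve the zero, then $L$ can be chosen to have a zero and $\varphi_1$, $\varphi_2$ can be chosen to preserve the zero. If $L_1$ and $L_2$ are finite, then $L$ can be chosen to be finite and atomistic.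
   Context: For a lattice $L$, $\operatorname{Con} L$ denotes the lattice of all congruences of $L$ ordered by inclusion; its least element is the equality congruence. A lattice homomorphism is a map preserving binary joins and meets; it is not required to preserve a zero or unit. The zero of a lattice is its least element (if it exists). For a lattice homomorphism $\varphi\colon K\to L$, the map $\operatorname{Con}\varphi\colon\operatorname{Con}K\to\operatorname{Con}L$ sends a congruence $\Theta$ of $K$ to the smallest congruence of $L$ containing all pairs $\langle\varphi x,\varphi y\rangle$ with $x,y\in K$ and $x\equiv y\ (\Theta)$. A complete $\bigvee$-homomorphism is a map preserving arbitrary joins, including the empty join (so it preserves the least element). A finite lattice is atomistic if every element is a join of atoms. *)

(* Defs.v *)
From HB Require Import structures.
From mathcomp Require Import all_boot all_order.
From mathcomp Require Import boolp classical_sets functions cardinality.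

Set Implicit Arguments.
Unset Strict Implicit.
Unset Printing Implicit Defensive.

Import Order.TTheory.

Local Open Scope classical_set_scope.
Local Open Scope order_scope.

Record congruence d (L : latticeType d) := Congruence {
  cong_rel :> L -> L -> Prop;
  cong_refl : forall x, cong_rel x x;
  cong_sym : forall x y, cong_rel x y -> cong_rel y x;
  cong_trans : forall x y z, cong_rel x y -> cong_rel y z -> cong_rel x z;
  cong_join : forall x y z t,
    cong_rel x y -> cong_rel z t -> cong_rel (x `|` z) (y `|` t);
  cong_meet : forall x y z t,
    cong_rel x y -> cong_rel z t -> cong_rel (x `&` z) (y `&` t)
}.

Fact con_display : Order.disp_t. Proof. exact: Order.Disp tt tt. Qed.

Section ConLattice.
Context d (L : latticeType d).
Implicit Types (a b c : congruence L) (R : L -> L -> Prop).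

Lemma congruenceP a b : (forall x y, a x y <-> b x y) -> a = b.
Proof.
case: a b => [r r1 r2 r3 r4 r5] [s s1 s2 s3 s4 s5] /= rs.
have ers : r = s by apply/funext => x; apply/funext => y; apply/propext.
rewrite -{}ers in s1 s2 s3 s4 s5 rs *.
by congr Congruence; apply: Prop_irrelevance.
Qed.

HB.instance Definition _ := gen_eqMixin (congruence L).
HB.instance Definition _ := gen_choiceMixin (congruence L).

Definition cong_le a b : bool := `[< forall x y, a x y -> b x y >].

Lemma cong_le_refl : reflexive cong_le.
Proof. by move=> a; apply/asboolP. Qed.

Lemma cong_le_anti : antisymmetric cong_le.
Proof.
move=> a b /andP[/asboolP ab /asboolP ba].
by apply: congruenceP => x y; split => [/ab|/ba].
Qed.

Lemma cong_le_trans : transitive cong_le.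
Proof.
move=> b a c /asboolP ab /asboolP bc.
by apply/asboolP => x y /ab /bc.
Qed.

HB.instance Definition _ := Order.Le_isPOrder.Build
  con_display (congruence L) cong_le_refl cong_le_anti cong_le_trans.

Lemma cong_leP a b : reflect (forall x y, a x y -> b x y) (a <= b).
Proof. exact: asboolP. Qed.

(* [cong_gen R] is the smallest congruence containing [R], see [cong_gen_le]. *)
Definition cong_gen R : congruence L.
Proof.
exists (fun x y => forall c, (forall u v, R u v -> c u v) -> c x y).
- by move=> x c _; exact: cong_refl.
- by move=> x y xy c Rc; apply/cong_sym/xy.
- by move=> x y z xy yz c Rc; exact: cong_trans (xy c Rc) (yz c Rc).
- by move=> x y z t xy zt c Rc; apply: cong_join; [exact: xy|exact: zt].
- by move=> x y z t xy zt c Rc; apply: cong_meet; [exact: xy|exact: zt].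
Defined.

Lemma cong_genS R x y : R x y -> cong_gen R x y.
Proof. by move=> Rxy c; exact. Qed.

Lemma cong_gen_le R a : cong_gen R <= a <-> forall x y, R x y -> a x y.
Proof.
split=> [/cong_leP ga x y /cong_genS|Ra]; first exact: ga.
by apply/cong_leP => x y; exact.
Qed.

Definition cong_inter a b : congruence L.
Proof.
exists (fun x y => a x y /\ b x y).
- by move=> x; split; exact: cong_refl.
- by move=> x y [? ?]; split; exact: cong_sym.
- by move=> x y z [xy xy'] [yz yz']; split; [exact: cong_trans xy yz|
    exact: cong_trans xy' yz'].
- by move=> x y z t [? ?] [? ?]; split; exact: cong_join.
- by move=> x y z t [? ?] [? ?]; split; exact: cong_meet.
Defined.

Definition cong_sup (S : set (congruence L)) : congruence L :=
  cong_gen (fun x y => exists2 a, S a & a x y).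

Lemma cong_sup_supremums S : supremums S (cong_sup S).
Proof.
split=> [a Sa|b Sb].
  by apply/cong_leP => x y axy; apply: cong_genS; exists a.
by apply/cong_gen_le => x y [a /Sb /cong_leP]; exact.
Qed.

Lemma cong_le_inter a b c : (a <= cong_inter b c) = (a <= b) && (a <= c).
Proof.
apply/cong_leP/andP => [h|[/cong_leP ab /cong_leP ac] x y axy].
  by split; apply/cong_leP => x y /h[].
by split; [exact: ab|exact: ac].
Qed.

Lemma cong_sup2_le a b c :
  (cong_sup [set a; b] <= c) = (a <= c) && (b <= c).
Proof.
apply/idP/andP => [h|[ac bc]].
  have [ub _] := cong_sup_supremums [set a; b].
  by split; apply: le_trans h; apply: ub; [left|right].
by have [_] := cong_sup_supremums [set a; b]; apply => _ [->|->].
Qed.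

HB.instance Definition _ := Order.POrder_MeetJoin_isLattice.Build
  _ (congruence L) cong_le_inter cong_sup2_le.

End ConLattice.

Definition con_map d (K : latticeType d) d' (L : latticeType d')
    (phi : K -> L) (Theta : congruence K) : congruence L :=
  cong_gen (fun u v => exists x y : K, [/\ Theta x y, u = phi x & v = phi y]).

(* All suprema exist in [congruence K], see [cong_sup_supremums]. The empty set is a legitimate
   [S], so such a map preserves the least element. *)
Definition complete_join_morphism d (P : porderType d) d' (Q : porderType d')
    (f : P -> Q) : Prop :=
  forall (S : set P) (s : P), supremums S s -> supremums (f @` S) (f s).

Definition is_zero d (L : latticeType d) (z : L) : Prop := forall x, z <= x.

Definition has_zero d (L : latticeType d) : Prop := exists z : L, is_zero z.

Definition preserves_zero d (K : latticeType d) d' (L : latticeType d')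
    (f : K -> L) : Prop :=
  forall z, is_zero z -> is_zero (f z).

Definition finite_lattice d (L : latticeType d) : Prop :=
  finite_set [set: L].

Definition atom d (L : latticeType d) (a : L) : Prop :=
  exists z : L, [/\ is_zero z, z < a & forall x, ~ (z < x < a)].

(* The zero is the supremum of [A = set0]. *)
Definition atomistic d (L : latticeType d) : Prop :=
  forall x : L, exists2 A : set L, A `<=` @atom d L & supremums A x.

Definition congruence_amalgam
    d0 (L0 : latticeType d0) d1 (L1 : latticeType d1) d2 (L2 : latticeType d2)
    dD (D : finDistrLatticeType dD)
    (eta1 : {lmorphism L0 -> L1}) (eta2 : {lmorphism L0 -> L2})
    (psi1 : congruence L1 -> D) (psi2 : congruence L2 -> D)
    d (L : latticeType d)
    (phi1 : {lmorphism L1 -> L}) (phi2 : {lmorphism L2 -> L}) : Prop :=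
  phi1 \o eta1 =1 phi2 \o eta2 /\
  exists alpha : {lmorphism congruence L -> D},
    [/\ bijective alpha,
        alpha \o con_map phi1 =1 psi1
      & alpha \o con_map phi2 =1 psi2].

(* Main.v *)
Require Import Defs.
From HB Require Import structures.
From mathcomp Require Import all_boot all_order.
From mathcomp Require Import boolp classical_sets functions cardinality.

Set Implicit Arguments.
Unset Strict Implicit.
Unset Printing Implicit Defensive.

Import Order.TTheory.

Local Open Scope classical_set_scope.
Local Open Scope order_scope.

(** Every element of the finite distributive lattice [D] is determined by the
    completely prime elements [p] below it, and for such a [p] the map
    [c |-> (p <= psi_i c)] turns joins into disjunctions.  Hence there is a
    largest congruence [prime_kernel psi_i p] of [L_i] whose image is not above
    [p], and [psi_i] is recovered from these kernels ([le_prime_kernel]).  The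
    hypothesis on [psi_1] and [psi_2] says exactly that, for each [p], the
    kernels on [L_1] and [L_2] have the same preimage in [L_0].  So the
    quotient of [L_0] by this preimage embeds in the quotients of [L_1] and
    [L_2] by the kernels at [p], and these two have a common extension: the
    lattice of those subsets of [L_1 + L_2] which are ideals modulo the kernel
    on either side and which contain both or neither of the two images of each
    element of [L_0].  Each [x] in [L_1] or [L_2] is sent to the ideal
    that it generates, which has an explicit description ([closure_inl],
    [closure_inr]).

    It remains to place these lattices of ideals, one for each [p], inside a
    single lattice with congruence lattice [D].  That lattice consists of
    subsets of a set of points, each of which lies at a level [p].  A point is
    either one of three copies of an element of [L_1 + L_2], or one of three
    additional points at infinity of its level.  A set is closed ([glued]) when,
    at each level, the elements all of whose copies it contains form an ideal,
    and when a point at infinity, together with any other point of the same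
    level [p] outside of the least closed set, brings in all the points of all
    the levels [q <= p].
    - Because elements are copied, every single point outside of the least
      closed set generates an atom, so a congruence [theta] that identifies two
      closed sets which differ at the level [p] collapses an atom of that level.
      Because of the points at infinity, it then collapses the whole level, and
      with it all the levels below ([collapse_level]).
    - Because nothing else links two levels, agreement at all the levels not
      below a given [d] in [D] is a congruence ([agree]).
    Hence [agree] is an isomorphism from [D] onto the congruence lattice
    ([agree_le], [congruence_agree]).  Principal ideals contain no point at
    infinity, so that the second closure condition leaves their joins alone and
    [x |-> glued_principal x] is a lattice morphism on each [L_i].  It
    identifies [x] and [y] at the level [p] exactly modulo the kernel at [p],
    which gives the formula for the induced maps on congruences
    ([con_map_agree]).

    The lattice so obtained is atomistic, has a zero, and is finite if [L_1]
    and [L_2] are.  Zeros are preserved provided that all ideals are required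
    to contain the zeros of [L_1] and [L_2]; this requirement is compatible
    with the description of principal ideals as soon as [eta_1] and [eta_2]
    preserve a zero of [L_0]. *)

(** * Completely prime elements of a finite distributive lattice *)

Section CompletelyPrime.
Context d (D : finDistrLatticeType d).
Implicit Types (x y p m : D).

(** In a finite lattice, the existence of a largest element [m] not above [p]
    says that [p] is below a join, possibly empty, only if it is below one of
    its terms.  Having [m] at hand dispenses with finite joins. *)
Definition completely_prime p : bool :=
  [exists m, [forall x, (p <= x) == ~~ (x <= m)]].

Lemma completely_primeP p :
  reflect (exists m, forall x, (p <= x) = ~~ (x <= m)) (completely_prime p).
Proof.
apply: (iffP existsP) => -[m h].
  by exists m => x; apply/eqP/(forallP h).
by exists m; apply/forallP => x; apply/eqP.
Qed.

Lemma join_closed_greatest (A : set D) x0 : A x0 ->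
    (forall x y, A x -> A y -> A (x `|` y)) ->
  exists2 m, A m & forall x, A x -> x <= m.
Proof.
move=> Ax0 AU.
have [m Am mmax] : exists2 m, A m & forall x, x \in enum D -> A x -> x <= m.
  elim: (enum D) => [|y s [m Am mmax]]; first by exists x0.
  have [Ay|nAy] := pselect (A y); last first.
    by exists m => // x; rewrite inE => /predU1P[->|/mmax].
  exists (m `|` y) => [|x]; first exact: AU.
  rewrite inE => /predU1P[-> _|xs Ax]; first exact: leUr.
  by apply: le_trans (leUl _ _); apply: mmax.
by exists m => // x; apply: mmax; rewrite mem_enum.
Qed.

(** A minimal [p] among the elements below [x] and not below [y] is prime by
    distributivity, as all smaller elements are below [y]; the elements not
    above [p] are therefore closed under joins and have a greatest one. *)
Lemma completely_prime_separates x y : ~~ (x <= y) ->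
  exists p, [/\ completely_prime p, p <= x & ~~ (p <= y)].
Proof.
move=> xy; pose A u := (u <= x) && ~~ (u <= y).
have Ax : A x by rewrite /A lexx.
case: (arg_minnP (fun u => #|[pred v | v <= u]|) Ax) => p /andP[px py] pmin.
have below_p u : u <= p -> ~~ (p <= u) -> u <= y.
  move=> up pu; apply/negPn/negP => uy.
  have /pmin : A u by rewrite /A uy (le_trans up px).
  rewrite leqNgt => /negP[]; apply/proper_card/fintype.properP; split.
    by apply/fintype.subsetP => v; rewrite !inE => /le_trans; apply.
  by exists p; rewrite !inE.
have primep u v : ~~ (p <= u) -> ~~ (p <= v) -> ~~ (p <= u `|` v).
  move=> pu pv; apply/negP => puv; move/negP: py; apply.
  rewrite -(meet_idPl puv) meetUr leUx.
  by rewrite !below_p ?leIl // lexI lexx.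
have [||m [pm ym] mmax] :=
    @join_closed_greatest [set u | ~~ (p <= u) /\ y <= u] y.
- by split.
- move=> u v [pu yu] [pv yv]; split; first exact: primep.
  exact: le_trans yu (leUl _ _).
exists p; split => //; apply/completely_primeP; exists m => u.
have [pu|pu] := boolP (p <= u).
  by apply/esym/negP => /(le_trans pu); apply/negP.
apply/esym/negbF/(@le_trans _ _ (u `|` y)); first exact: leUl.
by apply: mmax; split; [exact: primep|exact: leUr].
Qed.

End CompletelyPrime.

(** * Congruences *)

Section Congruences.
Context d (K : latticeType d) d' (L : latticeType d').

Definition cong_preim (f : {lmorphism K -> L}) (c : congruence L) :
  congruence K.
Proof.
exists (fun x y => c (f x) (f y)).
- by move=> x; exact: cong_refl.
- by move=> x y; exact: cong_sym.
- by move=> x y z; exact: cong_trans.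
- by move=> x y z t xy zt; rewrite !omorphU; exact: cong_join.
- by move=> x y z t xy zt; rewrite !omorphI; exact: cong_meet.
Defined.

Lemma con_map_le (f : {lmorphism K -> L}) a c :
  (con_map f a <= c) = (a <= cong_preim f c).
Proof.
apply/idP/cong_leP => [/cong_gen_le h x y axy|h].
  by apply: h; exists x, y.
by apply/cong_gen_le => _ _ [x [y [/h ? -> ->]]].
Qed.

End Congruences.

Lemma supremums_pair d (P : porderType d) (x y : P) :
  x <= y -> supremums [set x; y] y.
Proof.
move=> xy; split; first by move=> z [->|->].
by move=> z; apply; right.
Qed.

Lemma complete_join_morphism_le d (P : porderType d) d' (Q : porderType d')
    (f : P -> Q) :
  complete_join_morphism f -> {homo f : x y / x <= y}.
Proof.
move=> fJ x y /supremums_pair /fJ [+ _]; apply.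
by exists x => //; left.
Qed.

Section PrimeKernel.
Context d (L : latticeType d) d' (D : finDistrLatticeType d').
Variable psi : congruence L -> D.

(** For a complete join morphism [psi] and a completely prime [p], the largest
    congruence whose image is not above [p], by [le_prime_kernel]. *)
Definition prime_kernel (p : D) : congruence L :=
  cong_sup [set c | ~~ (p <= psi c)].

Lemma le_prime_kernel p c :
    complete_join_morphism psi -> completely_prime p ->
  (c <= prime_kernel p) = ~~ (p <= psi c).
Proof.
move=> psiJ /completely_primeP[m pm].
have kS := cong_sup_supremums [set c | ~~ (p <= psi c)].
apply/idP/idP => [|pc]; last by case: kS => + _; apply.
move=> /(complete_join_morphism_le psiJ) ck.
apply: contraTN ck => pc; apply: contraTN (pc) => ck.
rewrite pm negbK; apply: le_trans ck _.
have [_] := psiJ _ _ kS; apply => _ [b /= pb <-].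
by rewrite pm negbK in pb.
Qed.

End PrimeKernel.

(** * The lattice of closed sets of a closure system *)

Identity Coercion set_to_fun : set >-> Funclass.

Record closure_system (T : Type) := ClosureSystem {
  closed_in :> set (set T);
  closed_bigcap : forall S, S `<=` closed_in -> closed_in (\bigcap_(A in S) A)
}.

Record closed_set T (F : closure_system T) := ClosedSet {
  closed_carrier :> set T;
  closed_setP : F closed_carrier
}.

Fact closed_display : Order.disp_t. Proof. exact: Order.Disp tt tt. Qed.

Section ClosedSets.
Context (T : Type) (F : closure_system T).
Implicit Types (A B C : closed_set F) (X : set T).

Lemma closed_setext A B : (forall x, A x <-> B x) -> A = B.
Proof.
case: A B => [A FA] [B FB] /= /predeqP AB; case: _ / AB in FB *.
by congr ClosedSet; apply: Prop_irrelevance.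
Qed.

HB.instance Definition _ := gen_eqMixin (closed_set F).
HB.instance Definition _ := gen_choiceMixin (closed_set F).

Definition closed_le A B : bool := `[< A `<=` B >].

Lemma closed_le_refl : reflexive closed_le.
Proof. by move=> A; apply/asboolP. Qed.

Lemma closed_le_anti : antisymmetric closed_le.
Proof.
move=> A B /andP[/asboolP AB /asboolP BA].
by apply: closed_setext => x; split=> [/AB|/BA].
Qed.

Lemma closed_le_trans : transitive closed_le.
Proof.
by move=> B A C /asboolP AB /asboolP BC; apply/asboolP; exact: subset_trans BC.
Qed.

HB.instance Definition _ := Order.Le_isPOrder.Build
  closed_display (closed_set F) closed_le_refl closed_le_anti closed_le_trans.

Lemma closed_leP A B : reflect (A `<=` B) (A <= B).
Proof. exact: asboolP. Qed.

Lemma closed_le_in A B x : A <= B -> A x -> B x.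
Proof. by move/closed_leP; apply. Qed.

Lemma closure_subproof X : F (\bigcap_(A in [set A | F A /\ X `<=` A]) A).
Proof. by apply: closed_bigcap => A []. Qed.

Definition closure_of X : closed_set F := ClosedSet (closure_subproof X).

Lemma closure_of_le X A : (closure_of X <= A) <-> X `<=` A.
Proof.
split=> [/closed_leP cA x Xx|XA].
  by apply: cA => B [_]; apply.
by apply/closed_leP => x; apply; split; [exact: closed_setP|].
Qed.

Lemma closedI_subproof A B : F (A `&` B)%classic.
Proof.
suff -> : (A `&` B)%classic =
    \bigcap_(C in [set closed_carrier A; closed_carrier B]) C.
  by apply: closed_bigcap => _ [->|->]; exact: closed_setP.
apply/seteqP; split=> [x [Ax Bx] _ [->|->] //|x ABx].
by split; apply: ABx; [left|right].
Qed.

Definition closed_meet A B : closed_set F := ClosedSet (closedI_subproof A B).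

Definition closed_join A B : closed_set F := closure_of (A `|` B)%classic.

Lemma closed_le_meet A B C : (A <= closed_meet B C) = (A <= B) && (A <= C).
Proof.
apply/closed_leP/andP => [h|[/closed_leP AB /closed_leP AC] x Ax].
  by split; apply/closed_leP => x /h[].
by split; [exact: AB|exact: AC].
Qed.

Lemma closed_join_le A B C : (closed_join A B <= C) = (A <= C) && (B <= C).
Proof.
apply/idP/andP => [/closure_of_le h|[/closed_leP AC /closed_leP BC]].
  by split; apply/closed_leP => x ?; apply: h; [left|right].
by apply/closure_of_le => x [/AC|/BC].
Qed.

HB.instance Definition _ := Order.POrder_MeetJoin_isLattice.Build
  _ (closed_set F) closed_le_meet closed_join_le.

Lemma finite_closed_set : finite_set [set: T] -> finite_lattice (closed_set F).
Proof.
move=> /(@finite_seqP {classic T})[s sT].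
pose f A := [ffun i => `[< closed_carrier A (tnth (in_tuple s) i) >]].
have fI : injective f.
  move=> A B /ffunP fAB.
  apply: closed_setext => x.
  have /seq_tnthP[i ->] : (x : {classic T}) \in s.
    by have : [set: T] x by []; rewrite sT.
  by apply: asbool_eq_equiv; have := fAB i; rewrite !ffunE.
(* [f] embeds the closed sets into a finite type. *)
rewrite /finite_lattice; change (finite_set (f @^-1` setT)).
by apply: finite_preimage => [A B _ _ /fI//|]; exact: finite_finset.
Qed.

Lemma closed_setT : F setT.
Proof. by rewrite -(bigcap_set0 id); apply: closed_bigcap. Qed.

End ClosedSets.

(** * The glued lattice *)

Section GluedLattice.
Context dD (D : finDistrLatticeType dD) (X : Type).

Definition level := {p : D | completely_prime p}.

(** Three copies: a collapsed point at infinity still leaves two others, which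
    then collapse as in the lattice M3 ([collapse_level]). *)
Definition copy := option bool.

(** [(p, Some x, k)] is the [k]-th copy of [x] at the level [p], and
    [(p, None, k)] is a point at infinity of the level [p]. *)
Definition point : Type := level * option X * copy.

Variable F : level -> closure_system X.

Definition least_ideal (p : level) : set X := \bigcap_(I in F p) I.

Definition spread (I : level -> set X) : set point :=
  fun t => if t.1.2 is Some x then I t.1.1 x else False.

Definition bottom_points : set point := spread least_ideal.

Definition solid (C : set point) (p : level) : set X :=
  [set x | forall k, C (p, Some x, k)].

(** Under the first condition every one-point set is closed, up to
    [bottom_points], and families of ideals embed as a sublattice by [spread].
    Under the second one, a point at infinity joined with any other point
    outside of [bottom_points] gives its whole level, so that each level
    collapses as soon as one of its atoms does; it also makes the collapse of
    the level [p] entail that of every level [q <= p]. *)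
Definition glued (C : set point) : Prop :=
  (forall p, F p (solid C p)) /\
  (forall p k o j, C (p, None, k) -> C (p, o, j) -> (o, j) <> (None, k) ->
     ~ bottom_points (p, o, j) ->
   forall q i l, val q <= val p -> C (q, i, l)).

Lemma glued_bigcap (S : set (set point)) :
  S `<=` glued -> glued (\bigcap_(C in S) C).
Proof.
move=> Sg; split=> [p|p k o j Ck Co ojk nb q i l qp C SC]; last first.
  by have [_ gC] := Sg _ SC; apply: gC (Ck _ SC) (Co _ SC) ojk nb _ _ _ qp.
suff -> : solid (\bigcap_(C in S) C) p =
    \bigcap_(I in [set solid C p | C in S]) I.
  by apply: closed_bigcap => _ [C SC <-]; exact: (Sg _ SC).1.
apply/seteqP; split=> [x Sx _ [C SC <-] k|x Sx k C SC]; first exact: Sx.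
by have /(_ k) : solid C p x by apply: Sx; exists C.
Qed.

Definition glued_system := ClosureSystem glued_bigcap.
Definition glued_lattice := closed_set glued_system.
Implicit Types (A B C : glued_lattice) (p q : level) (d e : D) (t : point).

Lemma spread_glued I : (forall p, F p (I p)) -> glued (spread I).
Proof.
move=> FI; split=> // p; suff -> : solid (spread I) p = I p by [].
by apply/seteqP; split=> [x /(_ None)|x Ix k].
Qed.

Lemma spread_least I C : (forall p, I p `<=` solid C p) -> spread I `<=` C.
Proof. by move=> IC [[p [x|]] k] //= /IC /(_ k). Qed.

Lemma least_ideal_closed p : F p (least_ideal p).
Proof. exact: closed_bigcap. Qed.

Definition glued_bottom : glued_lattice :=
  ClosedSet (spread_glued least_ideal_closed : glued_system _).

Lemma glued_bottom_le C : glued_bottom <= C.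
Proof.
apply/closed_leP/spread_least => p x; apply.
by have [] := closed_setP C.
Qed.

Lemma bottom_points_in C t : bottom_points t -> C t.
Proof. exact: (closed_le_in (glued_bottom_le C)). Qed.

Lemma glued_point t : glued (bottom_points `|` [set t]).
Proof.
split=> [p|p k o j]; last first.
  by move=> [//|/= <-] [//|/= [-> ->]].
(* One point cannot provide all the copies of an element. *)
suff -> : solid (bottom_points `|` [set t]) p = least_ideal p.
  exact: least_ideal_closed.
apply/seteqP; split=> [x xt|x px k]; last by left.
have [//|/= tN] := xt None; have [//|/= ] := xt (Some true).
by rewrite -tN.
Qed.

Definition glued_atom t : glued_lattice :=
  ClosedSet (glued_point t : glued_system _).

Lemma glued_atom_le t C : C t -> glued_atom t <= C.
Proof.
move=> Ct; apply/closed_leP => s [|-> //].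
exact: bottom_points_in.
Qed.

(** The levels below [d] form a down-set, so filling them triggers no
    condition at any other level. *)
Lemma glued_fill d C : glued ([set t | val t.1.1 <= d] `|` C).
Proof.
have [CF Cg] := closed_setP C.
split=> [p|p k o j].
  have [pd|pd] := boolP (val p <= d).
    suff -> : solid ([set t | val t.1.1 <= d] `|` C) p = setT.
      exact: closed_setT.
    by apply/seteqP; split=> // x _ k; left.
  suff -> : solid ([set t | val t.1.1 <= d] `|` C) p = solid C p by [].
  apply/seteqP; split=> x xC k; last by right.
  by have [/= pd'|//] := xC k; rewrite pd' in pd.
have [pd _ _ _ _ q i l qp|pd] := boolP (val p <= d).
  by left; apply: le_trans qp pd.
move=> [/= pd'|Ck]; first by rewrite pd' in pd.
move=> [/= pd'|Co]; first by rewrite pd' in pd.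
by move=> ojk nb q i l qp; right; apply: Cg Ck Co ojk nb _ _ _ qp.
Qed.

Definition fill d C : glued_lattice :=
  ClosedSet (glued_fill d C : glued_system _).

Definition same_at p A B := forall o j, A (p, o, j) <-> B (p, o, j).

(** The join is computed inside the closed set [fill d (A' `|` B')], which does
    not add any point at the levels not below [d]. *)
Lemma agree_joinS d A A' B B' :
    (forall p, ~~ (val p <= d) -> same_at p A A') ->
    (forall p, ~~ (val p <= d) -> same_at p B B') ->
  A `|` B <= fill d (A' `|` B').
Proof.
have sub C C' E : (forall p, ~~ (val p <= d) -> same_at p C C') -> C' <= E ->
    C <= fill d E.
  move=> CC' /closed_leP C'E; apply/closed_leP => -[[p o] j] Cp.
  have [pd|pd] := boolP (val p <= d); first by left.
  by right; apply/C'E/CC'.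
by move=> AA' BB'; rewrite leUx (sub _ _ _ AA') ?leUl // (sub _ _ _ BB') ?leUr.
Qed.

Definition agree d : congruence glued_lattice.
Proof.
exists (fun A B => forall p, ~~ (val p <= d) -> same_at p A B).
- by [].
- by move=> A B AB p pd o j; split=> /(AB _ pd).
- move=> A B C AB BC p pd o j.
  by split=> [/(AB _ pd)/(BC _ pd)|/(BC _ pd)/(AB _ pd)].
- move=> A A' B B' AA' BB' p pd o j.
  have half C C' E E' : (forall q, ~~ (val q <= d) -> same_at q C C') ->
      (forall q, ~~ (val q <= d) -> same_at q E E') ->
      (C `|` E) (p, o, j) -> (C' `|` E') (p, o, j).
    move=> CC' EE' /(closed_le_in (agree_joinS CC' EE')) [/= pd'|//].
    by rewrite pd' in pd.
  split; first exact: half.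
  by apply: half => q qd i l; apply: iff_sym; [exact: AA'|exact: BB'].
- move=> A A' B B' AA' BB' p pd o j.
  by split=> -[/(AA' _ pd) ? /(BB' _ pd)].
Defined.

Lemma agree_le d e : (agree d <= agree e) = (d <= e).
Proof.
apply/idP/idP => [/cong_leP de|de]; last first.
  apply/cong_leP => A B AB p pe; apply: AB.
  by apply: contra pe => /le_trans; apply.
apply/negPn/negP => /completely_prime_separates[p [pp pd pe]].
have /de : agree d (fill d glued_bottom) glued_bottom.
  by move=> q qd o j; split=> [[/= qd'|//]|]; [rewrite qd' in qd|right].
move/(_ (exist _ p pp) pe None None) => [/= + _]; apply.
by left.
Qed.

Section Collapse.
Variable theta : congruence glued_lattice.

Lemma collapse_atom A B t : theta A B -> A t -> ~ B t ->
  theta (glued_atom t) glued_bottom.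
Proof.
move=> AB At nBt.
have := cong_meet (cong_refl theta (glued_atom t)) AB.
rewrite (meet_idPl (glued_atom_le At)).
suff -> : glued_atom t `&` B = glued_bottom by [].
apply/le_anti; rewrite glued_bottom_le andbT.
by apply/closed_leP => s [[//|/= -> /nBt]].
Qed.

Lemma fill_le_join p k o j d : (o, j) <> (None, k) ->
    ~ bottom_points (p, o, j) -> d <= val p ->
  fill d glued_bottom <= glued_atom (p, None, k) `|` glued_atom (p, o, j).
Proof.
move=> ojk nb dp; set J := _ `|` _; have [_ Jg] := closed_setP J.
apply/closed_leP => -[[q i] l] [qd|]; last exact: bottom_points_in.
apply: Jg ojk nb _ _ _ (le_trans qd dp).
- by apply: (closed_le_in (leUl _ _)); right.
- by apply: (closed_le_in (leUr _ _)); right.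
Qed.

(** Joining the collapsed atom to the point at infinity [k] fills the level, so
    that [k] alone is congruent to the whole level; meet with [l]. *)
Lemma collapse_inf p k l o j : theta (glued_atom (p, o, j)) glued_bottom ->
    ~ bottom_points (p, o, j) -> (o, j) <> (None, k) -> k <> l ->
  theta (glued_atom (p, None, l)) glued_bottom.
Proof.
move=> ojb nb ojk kl.
have := cong_join (cong_refl theta (glued_atom (p, None, k))) ojb.
rewrite (join_idPl (glued_bottom_le _)).
move/(cong_meet (cong_refl theta (glued_atom (p, None, l)))).
rewrite (meet_idPl _); last first.
  apply: glued_atom_le; apply: (closed_le_in (fill_le_join ojk nb (lexx _))).
  by left => /=.
suff -> : glued_atom (p, None, l) `&` glued_atom (p, None, k) = glued_bottom.
  by [].
apply/le_anti; rewrite glued_bottom_le andbT.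
apply/closed_leP => s [[//|/= ->] [//|/= [lk]]].
by case: kl.
Qed.

Lemma two_other_copies (j : copy) :
  exists k l : copy, [/\ k <> l, j <> k & j <> l].
Proof.
case: j => [[]|]; [exists None, (Some false)|exists None, (Some true)|
  exists (Some true), (Some false)]; by split.
Qed.

(** Two points at infinity distinct from [t] collapse, and their join fills the
    level. *)
Lemma collapse_level A B t : theta A B -> A t -> ~ B t ->
  theta (fill (val t.1.1) glued_bottom) glued_bottom.
Proof.
case: t => -[p o] j AB At nBt.
have nb : ~ bottom_points (p, o, j).
  by move=> bt; apply: nBt; exact: bottom_points_in.
have ab := collapse_atom AB At nBt.
have [k [l [kl jk jl]]] := two_other_copies j.
have ojk : (o, j) <> (None, k) by case.
have ojl : (o, j) <> (None, l) by case.
have tk := collapse_inf ab nb ojl (nesym kl).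
have tl := collapse_inf ab nb ojk kl.
have lk : ((None, l) : option X * copy) <> (None, k) by move=> [/esym].
have := cong_join tk tl; rewrite joinxx.
move/(cong_meet (cong_refl theta (fill (val p) glued_bottom))).
rewrite (meet_idPl _); last exact: fill_le_join.
by rewrite (meet_idPr _) // glued_bottom_le.
Qed.

(** The [d] for which [theta] collapses the filled levels below [d] are closed
    under joins, because each level below [d `|` e] is below [d] or [e].  The
    greatest of them is the required element: the levels where congruent sets
    differ are below it by [collapse_level], and sets which differ only there
    become equal after joining with the collapsed levels. *)
Lemma congruence_agree (z : D) : (forall d, z <= d) ->
  exists d, agree d = theta.
Proof.
move=> z_le; pose S := [set d | theta (fill d glued_bottom) glued_bottom].
have [||d Sd dmax] := @join_closed_greatest _ _ S z.
- (* No level is below [z], so that filling does nothing. *)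
  rewrite /S /=; suff -> : fill z glued_bottom = glued_bottom.
    exact: cong_refl.
  apply/le_anti; rewrite glued_bottom_le andbT.
  apply/closed_leP => t [/= tz|//].
  case/completely_primeP: (valP t.1.1) => m mP.
  by have := mP z; rewrite tz z_le.
- move=> d e Sd Se; have := cong_join Sd Se; rewrite joinxx.
  move/(cong_meet (cong_refl theta (fill (d `|` e) glued_bottom))).
  rewrite (meet_idPl _) ?(meet_idPr (glued_bottom_le _)) //.
  apply/closed_leP => -[[p o] j] [pde|]; last exact: bottom_points_in.
  case/completely_primeP: (valP p) => m pP.
  move: (pde : val p <= d `|` e); rewrite pP leUx negb_and -!pP => /orP[] pd.
    by apply: (closed_le_in (leUl (fill d glued_bottom) _)); left.
  by apply: (closed_le_in (leUr (fill e glued_bottom) _)); left.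
exists d; apply: congruenceP => A B; split=> [AB|AB p pd o j].
  have filled C : theta C (C `|` fill d glued_bottom).
    have := cong_join (cong_refl theta C) (cong_sym Sd).
    by rewrite (join_idPl (glued_bottom_le C)).
  have same : A `|` fill d glued_bottom = B `|` fill d glued_bottom.
    have half C C' : agree d C C' ->
        C `|` fill d glued_bottom <= C' `|` fill d glued_bottom.
      move=> CC'; rewrite leUx leUr andbT; apply/closed_leP => -[[p o] j] Cp.
      have [pd|/CC' CC'p] := boolP (val p <= d).
        by apply: (closed_le_in (leUr _ _)); left.
      by apply: (closed_le_in (leUl _ _)); apply/CC'p.
    by apply/le_anti; rewrite !half //; exact: cong_sym.
  by apply: cong_trans (filled A) _; rewrite same; apply: cong_sym.
have half C C' : theta C C' -> C (p, o, j) -> C' (p, o, j).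
  move=> CC' Cp; apply: contrapT => nC'p; move/negP: pd; apply.
  exact: dmax (collapse_level CC' Cp nC'p).
by split; apply: half => //; apply: cong_sym.
Qed.

End Collapse.

Lemma glued_atom_atom t : ~ bottom_points t -> atom (glued_atom t).
Proof.
move=> nb; exists glued_bottom; split=> [|| C /andP[bC Ct]].
- exact: glued_bottom_le.
- rewrite lt_neqAle glued_bottom_le andbT; apply/eqP => bt; apply: nb.
  have : glued_atom t t by right.
  by rewrite -bt.
have [/glued_atom_le tC|nCt] := pselect (C t).
  by have := le_lt_trans tC Ct; rewrite ltxx.
suff /(lt_le_trans bC) : C <= glued_bottom by rewrite ltxx.
apply/closed_leP => s Cs; have [//|/= st] := closed_le_in (ltW Ct) Cs.
by rewrite st in Cs.
Qed.

Lemma glued_atomistic : atomistic glued_lattice.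
Proof.
move=> C; exists [set A | atom A /\ A <= C] => [A []//|].
split=> [A []//|U ubU]; apply/closed_leP => t Ct.
have [bt|nb] := pselect (bottom_points t).
  exact: bottom_points_in.
have /ubU/closed_leP : [set A | atom A /\ A <= C] (glued_atom t).
  by split; [exact: glued_atom_atom|exact: glued_atom_le].
by apply; right.
Qed.

Lemma glued_finite : finite_set [set: X] -> finite_lattice glued_lattice.
Proof.
move=> finX; apply: finite_closed_set.
suff -> : [set: point] = [set: level * option X] `*` [set: copy].
  apply: finite_setX; last exact: finite_finset.
  suff -> : [set: level * option X] =
      [set: level] `*` (None |` Some @` [set: X]).
    apply: finite_setX; first exact: finite_finset.
    by rewrite finite_setU; split; [exact: finite_set1|exact: finite_image].
  by apply/seteqP; split=> // -[p [x|]] _; split=> //; [right; exists x|left].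
by apply/seteqP.
Qed.

End GluedLattice.

(** * Principal ideals as a lattice morphism *)

Lemma lmorphism_exists d (K : latticeType d) d' (L : latticeType d')
    (f : K -> L) :
    {morph f : x y / x `&` y} -> {morph f : x y / x `|` y} ->
  exists g : {lmorphism K -> L}, g = f :> (K -> L).
Proof.
move=> fI fU; have f_le : {homo f : x y / x <= y}.
  by move=> x y /meet_idPl xy; rewrite -xy fI leIr.
pose f_order := Order.isOrderMorphism.Build _ _ _ _ _ f_le.
pose f_meet := Order.isMeetLatticeMorphism.Build _ _ _ _ _ fI.
pose f_join := Order.isJoinLatticeMorphism.Build _ _ _ _ _ fU.
pose g : {lmorphism K -> L} := HB.pack f f_order f_meet f_join.
by exists g.
Qed.

Lemma order_iso_inverse d (K : latticeType d) d' (L : latticeType d')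
    (f : K -> L) : {mono f : x y / x <= y} -> (forall y, exists x, f x = y) ->
  exists g : {lmorphism L -> K}, bijective g /\ cancel f g.
Proof.
move=> f_mono f_surj; pose h y := sval (cid (f_surj y)).
have hK : cancel h f by move=> y; rewrite /h; case: cid.
have fK : cancel f h.
  by move=> x; apply/le_anti; rewrite -!f_mono hK lexx.
have h_le x y : (x <= h y) = (f x <= y) by rewrite -f_mono hK.
have h_ge x y : (h x <= y) = (x <= f y) by rewrite -f_mono hK.
have [||g gE] := @lmorphism_exists _ _ _ _ h.
- move=> x y; apply/le_anti; rewrite lexI !h_ge !hK leIl leIr /=.
  by rewrite h_le lexI -!h_le leIl leIr.
- move=> x y; apply/le_anti; rewrite leUx !h_le !hK leUl leUr !andbT.
  by rewrite h_ge leUx -!h_ge leUl leUr.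
by exists g; rewrite gE; split=> //; exists f.
Qed.

Section PrincipalIdeals.
Context dD (D : finDistrLatticeType dD) (X : Type).
Variable F : level D -> closure_system X.

Definition glued_principal (u : X) : glued_lattice F :=
  ClosedSet (spread_glued (fun p => closed_setP (closure_of (F p) [set u])) :
    glued_system F _).

Lemma glued_principal_le u (C : glued_lattice F) :
  glued_principal u <= C <-> forall p, solid C p u.
Proof.
split=> [uC p k|uC].
  by apply: (closed_le_in uC) => I [_]; apply.
apply/closed_leP/spread_least => p x; apply; split.
  exact: (closed_setP C).1.
by move=> _ ->.
Qed.

Lemma same_at_glued_principal p u v :
  same_at p (glued_principal u) (glued_principal v) <->
  closure_of (F p) [set v] u /\ closure_of (F p) [set u] v.
Proof.
have self w : closure_of (F p) [set w] w by move=> I [_]; apply.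
split=> [uv|[vu uv] [x|] j //].
  split; first exact: (uv (Some u) None).1 (self u).
  exact: (uv (Some v) None).2 (self v).
have half w w' : closure_of (F p) [set w'] w ->
    closure_of (F p) [set w] x -> closure_of (F p) [set w'] x.
  move=> ww' wx; apply: wx; split; first exact: closed_setP.
  by move=> _ ->.
by split; apply: half.
Qed.

(** Joins are preserved because [glued_principal u <= C] is the statement that,
    at every level, the ideal [solid C p] contains [u]; points at infinity do
    not intervene. *)
Lemma principal_morphism d (K : latticeType d) (inj : K -> X) :
    (forall p I x y, F p I -> x <= y -> I (inj y) -> I (inj x)) ->
    (forall p I x y, F p I -> I (inj x) -> I (inj y) -> I (inj (x `|` y))) ->
    (forall p x y u, closure_of (F p) [set inj x] u ->
       closure_of (F p) [set inj y] u ->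
       closure_of (F p) [set inj (x `&` y)] u) ->
  exists phi : {lmorphism K -> glued_lattice F},
    forall x, phi x = glued_principal (inj x).
Proof.
move=> injS injU injI.
have homo_le : {homo glued_principal \o inj : x y / x <= y}.
  move=> x y xy; apply/glued_principal_le => p.
  have Fp := (closed_setP (glued_principal (inj y))).1 p.
  by apply: injS Fp xy _; exact: (glued_principal_le _ _).1 (lexx _) p.
have [||phi phiE] := @lmorphism_exists _ _ _ _ (glued_principal \o inj).
- move=> x y; apply/le_anti; rewrite lexI !homo_le ?leIl ?leIr //=.
  apply/closed_leP => -[[p [u|]] k] [] //; exact: injI.
- move=> x y; apply/le_anti; rewrite leUx !homo_le ?leUl ?leUr // !andbT.
  apply: (glued_principal_le _ _).2 => p.
  set J := _ `|` _; have Fp := (closed_setP J).1 p.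
  by apply: injU Fp _ _; apply: (glued_principal_le _ _).1 _ p;
    [exact: leUl|exact: leUr].
by exists phi => x; rewrite phiE.
Qed.

End PrincipalIdeals.

(** * Amalgamating two lattices modulo congruences *)

Section Below.
Context d (K : latticeType d) (c : congruence K).
Implicit Types (x y z : K).

(** The order of the quotient of [K] by [c]. *)
Definition below x y : Prop := c (x `&` y) x.

Lemma below_joinE x y : below x y <-> c (x `|` y) y.
Proof.
split=> [/(fun xy => cong_join xy (cong_refl c y))|].
  by rewrite meetUK => /cong_sym.
move/(fun xy => cong_meet (cong_refl c x) xy).
by rewrite joinKI => /cong_sym.
Qed.

Lemma le_below x y : x <= y -> below x y.
Proof. by move=> /meet_idPl xy; rewrite /below xy; exact: cong_refl. Qed.

Lemma below_trans y x z : below x y -> below y z -> below x z.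
Proof.
move=> xy yz; rewrite /below.
have /cong_sym := cong_meet xy (cong_refl c z) => h; apply: cong_trans h _.
apply: cong_trans xy; rewrite -meetA.
exact: cong_meet (cong_refl c x) yz.
Qed.

Lemma below_meet x y z : below z x -> below z y -> below z (x `&` y).
Proof.
move=> zx zy; rewrite /below meetA.
exact: cong_trans (cong_meet zx (cong_refl c y)) zy.
Qed.

Lemma below_join x y z : below x z -> below y z -> below (x `|` y) z.
Proof.
move=> /below_joinE xz /below_joinE yz; apply/below_joinE; rewrite -joinA.
exact: cong_trans (cong_join (cong_refl c x) yz) xz.
Qed.

Lemma below_anti x y : c x y <-> below x y /\ below y x.
Proof.
split=> [xy|[xy yx]].
  split; rewrite /below.
    by have := cong_meet (cong_refl c x) (cong_sym xy); rewrite meetxx.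
  by have := cong_meet (cong_refl c y) xy; rewrite meetxx.
by apply: cong_trans (cong_sym xy) _; rewrite meetC.
Qed.

End Below.

Lemma below_preim d (K : latticeType d) d' (L : latticeType d')
    (f : {lmorphism K -> L}) (c : congruence L) x y :
  below (cong_preim f c) x y <-> below c (f x) (f y).
Proof. by rewrite /below /= omorphI. Qed.

Section AmalgamIdeals.
Context d0 (L0 : latticeType d0) d1 (L1 : latticeType d1)
  d2 (L2 : latticeType d2).
Variables (eta1 : {lmorphism L0 -> L1}) (eta2 : {lmorphism L0 -> L2}).
Variables (c1 : congruence L1) (c2 : congruence L2) (Z : Prop).

(** Ideals of the quotient of [K] by [c], required to contain the zeros of [K]
    when [Z] holds; the empty set is accepted otherwise. *)
Definition ideal_mod d (K : latticeType d) (c : congruence K) (I : set K) :=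
  [/\ forall x y, below c x y -> I y -> I x,
      forall x y, I x -> I y -> I (x `|` y)
    & Z -> forall z, is_zero z -> I z].

Definition amalgam_ideal (I1 : set L1) (I2 : set L2) : Prop :=
  [/\ ideal_mod c1 I1, ideal_mod c2 I2
    & forall x, I1 (eta1 x) <-> I2 (eta2 x)].

Definition down (x : L1) : set L1 := [set y | below c1 y x].

(** In the amalgam, an element of [L2] is below an element of [L1] if some
    element of [L0] lies between them. *)
Definition across (x : L1) : set L2 :=
  [set y | exists2 z, below c2 y (eta2 z) & below c1 (eta1 z) x].

Hypothesis c12 : cong_preim eta1 c1 = cong_preim eta2 c2.
Hypothesis zeros : Z -> exists2 z, is_zero (eta1 z) & is_zero (eta2 z).

(** The equality [c12] matters where the two sides meet: if [eta2 z] is in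
    [across x] by way of [w], that is, if [eta2 z] is below [eta2 w] and
    [eta1 w] below [x], then [eta1 z] is below [eta1 w], and so below [x],
    because [c1] and [c2] induce the same order on [L0]. *)
Lemma amalgam_ideal_principal x : amalgam_ideal (down x) (across x).
Proof.
split=> [||z]; first split.
- by move=> y z; exact: below_trans.
- by move=> y z; exact: below_join.
- by move=> _ z z0; exact/le_below/z0.
- split=> [y z yz [w zw wx]|y z [v yv vx] [w zw wx]|/zeros[z z1 z2] y y0].
  + by exists w => //; apply: below_trans yz zw.
  + exists (v `|` w); rewrite omorphU; last exact: below_join.
    apply: below_join; [apply: below_trans yv _|apply: below_trans zw _].
      by apply: le_below; exact: leUl.
    by apply: le_below; exact: leUr.
  + by exists z; apply: le_below; [exact: y0|exact: z1].
- split=> [zx|[w /below_preim zw wx]].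
    by exists z => //; exact: le_below.
  by apply: below_trans wx; apply/below_preim; rewrite c12.
Qed.

Lemma principal_least x I1 I2 : amalgam_ideal I1 I2 -> I1 x ->
  down x `<=` I1 /\ across x `<=` I2.
Proof.
move=> [[I1S _ _] [I2S _ _] I12] I1x; split=> [y yx|y [z yz zx]].
  exact: I1S yx I1x.
by apply: I2S yz _; apply/I12; apply: I1S zx I1x.
Qed.

Lemma down_meet x y : down x `&` down y `<=` down (x `&` y).
Proof. by move=> z [zx zy]; apply: below_meet. Qed.

Lemma across_meet x y : across x `&` across y `<=` across (x `&` y).
Proof.
move=> z [[v zv vx] [w zw wy]]; exists (v `&` w); rewrite omorphI.
  exact: below_meet.
apply: below_meet.
  by apply: below_trans vx; apply: le_below; exact: leIl.
by apply: below_trans wy; apply: le_below; exact: leIr.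
Qed.

Definition split_ideal (I : set (L1 + L2)) : Prop :=
  amalgam_ideal (I \o inl) (I \o inr).

Lemma split_ideal_bigcap (S : set (set (L1 + L2))) :
  S `<=` split_ideal -> split_ideal (\bigcap_(I in S) I).
Proof.
move=> Sid; split; [split|split|].
- move=> x y xy Iy I SI; have [[h _ _] _ _] := Sid _ SI.
  exact: h xy (Iy _ SI).
- move=> x y Ix Iy I SI; have [[_ h _] _ _] := Sid _ SI.
  exact: h (Ix _ SI) (Iy _ SI).
- by move=> HZ z z0 I SI; have [[_ _ h] _ _] := Sid _ SI; exact: h.
- move=> x y xy Iy I SI; have [_ [h _ _] _] := Sid _ SI.
  exact: h xy (Iy _ SI).
- move=> x y Ix Iy I SI; have [_ [_ h _] _] := Sid _ SI.
  exact: h (Ix _ SI) (Iy _ SI).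
- by move=> HZ z z0 I SI; have [_ [_ _ h] _] := Sid _ SI; exact: h.
- move=> x; split=> Ix I SI; have [_ _ h] := Sid _ SI.
    exact: (h x).1 (Ix _ SI).
  exact: (h x).2 (Ix _ SI).
Qed.

Definition ideal_system := ClosureSystem split_ideal_bigcap.

End AmalgamIdeals.

Lemma amalgam_idealC d0 (L0 : latticeType d0) d1 (L1 : latticeType d1)
    d2 (L2 : latticeType d2)
    (eta1 : {lmorphism L0 -> L1}) (eta2 : {lmorphism L0 -> L2})
    (c1 : congruence L1) (c2 : congruence L2) (Z : Prop) I1 I2 :
  amalgam_ideal eta1 eta2 c1 c2 Z I1 I2 ->
  amalgam_ideal eta2 eta1 c2 c1 Z I2 I1.
Proof. by move=> [h1 h2 h12]; split=> // x; apply: iff_sym. Qed.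

Section PrincipalSplitIdeals.
Context d0 (L0 : latticeType d0) d1 (L1 : latticeType d1)
  d2 (L2 : latticeType d2).
Variables (eta1 : {lmorphism L0 -> L1}) (eta2 : {lmorphism L0 -> L2}).
Variables (c1 : congruence L1) (c2 : congruence L2) (Z : Prop).
Hypothesis c12 : cong_preim eta1 c1 = cong_preim eta2 c2.
Hypothesis zeros : Z -> exists2 z, is_zero (eta1 z) & is_zero (eta2 z).
Let F := ideal_system eta1 eta2 c1 c2 Z.

Definition principal_inl (x : L1) : set (L1 + L2) := fun u =>
  match u with
  | inl y => down c1 x y
  | inr y => across eta1 eta2 c1 c2 x y
  end.

Definition principal_inr (x : L2) : set (L1 + L2) := fun u =>
  match u with
  | inl y => across eta2 eta1 c2 c1 x y
  | inr y => down c2 x y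
  end.

Lemma closure_inl x u : closure_of F [set inl x] u <-> principal_inl x u.
Proof.
split=> [xu|xu I [FI /(_ _ erefl) Ix]].
  apply: xu; split=> [|_ ->]; first exact: amalgam_ideal_principal.
  exact: le_below.
have [downI acrossI] := principal_least FI Ix.
by case: u xu => y; [exact: downI|exact: acrossI].
Qed.

Lemma closure_inr x u : closure_of F [set inr x] u <-> principal_inr x u.
Proof.
have zerosC : Z -> exists2 z, is_zero (eta2 z) & is_zero (eta1 z).
  by move=> /zeros[z z1 z2]; exists z.
split=> [xu|xu I [/amalgam_idealC FI /(_ _ erefl) Ix]].
  apply: xu; split=> [|_ ->]; last exact: le_below.
  exact/amalgam_idealC/amalgam_ideal_principal.
have [downI acrossI] := principal_least FI Ix.
by case: u xu => y; [exact: acrossI|exact: downI].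
Qed.

End PrincipalSplitIdeals.


(** * The amalgam *)

Lemma join_morphism_sup0 d (K : latticeType d) d' (P : porderType d')
    (f : congruence K -> P) :
  complete_join_morphism f -> forall x, f (cong_sup set0) <= x.
Proof.
move=> /(_ _ _ (@cong_sup_supremums _ K set0))[_ f0] x.
by apply: f0 => _ [? []].
Qed.

(** A completely prime [p] is below the element [e] with
    [con_map phi c = agree F e] iff [c] identifies two elements whose images
    differ at the level [p], that is, iff [c] is not below the kernel at [p],
    that is, iff [p <= psi c]. *)
Lemma con_map_agree dD (D : finDistrLatticeType dD) (X : Type)
    (F : level D -> closure_system X) d (K : latticeType d)
    (psi : congruence K -> D) (phi : {lmorphism K -> glued_lattice F}) :
    complete_join_morphism psi ->
    (forall p x y,
       same_at p (phi x) (phi y) <-> prime_kernel psi (val p) x y) ->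
  forall c, con_map phi c = agree F (psi c).
Proof.
move=> psiJ phi_ker c.
have [e ce] := congruence_agree (con_map phi c) (join_morphism_sup0 psiJ).
rewrite -ce; congr (agree F); apply/le_anti/andP; split.
  rewrite -(agree_le F) ce con_map_le; apply/cong_leP => x y cxy p pc.
  apply/phi_ker; move: pc; rewrite -le_prime_kernel ?(valP p) //.
  by move/cong_leP; apply.
apply/negPn/negP => /completely_prime_separates[p [pp pc pe]].
suff : ~~ (p <= psi c) by rewrite pc.
rewrite -le_prime_kernel //; apply/cong_leP => x y cxy.
apply/(phi_ker (exist _ p pp)).
have : agree F e (phi x) (phi y) by rewrite ce; apply: cong_genS; exists x, y.
exact.
Qed.

Section Construction.
Context d0 (L0 : latticeType d0) d1 (L1 : latticeType d1)
  d2 (L2 : latticeType d2).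
Variables (eta1 : {lmorphism L0 -> L1}) (eta2 : {lmorphism L0 -> L2}).
Context dD (D : finDistrLatticeType dD).
Variables (psi1 : congruence L1 -> D) (psi2 : congruence L2 -> D).
Hypothesis psi1_join : complete_join_morphism psi1.
Hypothesis psi2_join : complete_join_morphism psi2.
Hypothesis psi_eta : psi1 \o con_map eta1 =1 psi2 \o con_map eta2.

Let with_zeros : Prop :=
  [/\ has_zero L0, preserves_zero eta1 & preserves_zero eta2].

Let ker1 (p : level D) := prime_kernel psi1 (val p).
Let ker2 (p : level D) := prime_kernel psi2 (val p).
Let F (p : level D) := ideal_system eta1 eta2 (ker1 p) (ker2 p) with_zeros.

(** Both preimages are the largest congruence of [L0] sent to an element not
    above [p] by the common composite of [psi_eta]. *)
Let ker12 p : cong_preim eta1 (ker1 p) = cong_preim eta2 (ker2 p).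
Proof.
have same c : (c <= cong_preim eta1 (ker1 p)) = (c <= cong_preim eta2 (ker2 p)).
  rewrite -!con_map_le !le_prime_kernel ?(valP p) //.
  by rewrite [psi1 _]psi_eta.
by apply/le_anti; rewrite same lexx -same lexx.
Qed.

Let common_zero :
  with_zeros -> exists2 z, is_zero (eta1 z) & is_zero (eta2 z).
Proof. by move=> [[z z0] e1 e2]; exists z; [exact: e1|exact: e2]. Qed.

Let inlE p x u := closure_inl (ker12 p) common_zero x u.
Let inrE p x u := closure_inr (ker12 p) common_zero x u.

(** One lattice has all the required properties at once. *)
Lemma amalgamation : exists d (L : latticeType d)
    (phi1 : {lmorphism L1 -> L}) (phi2 : {lmorphism L2 -> L}),
  [/\ congruence_amalgam eta1 eta2 psi1 psi2 phi1 phi2,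
      with_zeros -> [/\ has_zero L, preserves_zero phi1 & preserves_zero phi2]
    & finite_lattice L1 -> finite_lattice L2 ->
        finite_lattice L /\ atomistic L].
Proof.
have [|||phi1 phi1E] := @principal_morphism _ D _ F _ L1 inl.
- by move=> p I x y [[IS _ _] _ _] xy; apply/IS/le_below.
- by move=> p I x y [[_ IU _] _ _]; exact: IU.
- move=> p x y u /inlE xu /inlE yu; apply/inlE.
  by case: u xu yu => z xz yz; [exact: down_meet|exact: across_meet].
have [|||phi2 phi2E] := @principal_morphism _ D _ F _ L2 inr.
- by move=> p I x y [_ [IS _ _] _] xy; apply/IS/le_below.
- by move=> p I x y [_ [_ IU _] _]; exact: IU.
- move=> p x y u /inrE xu /inrE yu; apply/inrE.
  by case: u xu yu => z xz yz; [exact: across_meet|exact: down_meet].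
have phi1_ker p x y : same_at p (phi1 x) (phi1 y) <-> ker1 p x y.
  rewrite !phi1E; apply: (iff_trans (same_at_glued_principal _ _ _ _)).
  apply: iff_sym; apply: (iff_trans (below_anti _ _ _)).
  by split=> [[xy yx]|[/inlE xy /inlE yx]]; split=> //; apply/inlE.
have phi2_ker p x y : same_at p (phi2 x) (phi2 y) <-> ker2 p x y.
  rewrite !phi2E; apply: (iff_trans (same_at_glued_principal _ _ _ _)).
  apply: iff_sym; apply: (iff_trans (below_anti _ _ _)).
  by split=> [[xy yx]|[/inrE xy /inrE yx]]; split=> //; apply/inrE.
have [||alpha [alpha_bij alphaK]] := @order_iso_inverse _ _ _ _ (agree F).
- exact: agree_le.
- by move=> c; exact: congruence_agree (join_morphism_sup0 psi1_join).
exists closed_display, (glued_lattice F), phi1, phi2; split.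
- split=> [x /=|].
    rewrite phi1E phi2E; apply/le_anti/andP.
    split; apply/glued_principal_le => p.
      have [_ _ h] := (closed_setP (glued_principal F (inr (eta2 x)))).1 p.
      by apply/h/(glued_principal_le _ _).1.
    have [_ _ h] := (closed_setP (glued_principal F (inl (eta1 x)))).1 p.
    by apply/h/(glued_principal_le _ _).1.
  exists alpha; split=> // c /=.
    by rewrite (con_map_agree psi1_join phi1_ker) alphaK.
  by rewrite (con_map_agree psi2_join phi2_ker) alphaK.
- move=> zs; split; first by exists (glued_bottom F); exact: glued_bottom_le.
    move=> z z0 C; rewrite phi1E; apply/glued_principal_le => p.
    by have [[_ _ h] _ _] := (closed_setP C).1 p; apply: h.
  move=> z z0 C; rewrite phi2E; apply/glued_principal_le => p.
  by have [_ [_ _ h] _] := (closed_setP C).1 p; apply: h.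
- move=> fin1 fin2; split; last exact: glued_atomistic.
  apply: glued_finite.
  suff -> : [set: L1 + L2] = inl @` setT `|` inr @` setT.
    by rewrite finite_setU; split; exact: finite_image.
  by apply/seteqP; split=> // -[x|x] _; [left|right]; exists x.
Qed.

End Construction.

Theorem theorem1
  (d0 : Order.disp_t) (L0 : latticeType d0)
  (d1 : Order.disp_t) (L1 : latticeType d1)
  (d2 : Order.disp_t) (L2 : latticeType d2)
  (eta1 : {lmorphism L0 -> L1}) (eta2 : {lmorphism L0 -> L2})
  (dD : Order.disp_t) (D : finDistrLatticeType dD)
  (psi1 : congruence L1 -> D) (psi2 : congruence L2 -> D)
  (psi1_join : complete_join_morphism psi1)
  (psi2_join : complete_join_morphism psi2)
  (psi_eta : psi1 \o con_map eta1 =1 psi2 \o con_map eta2) :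
  (exists (d : Order.disp_t) (L : latticeType d)
     (phi1 : {lmorphism L1 -> L}) (phi2 : {lmorphism L2 -> L}),
     congruence_amalgam eta1 eta2 psi1 psi2 phi1 phi2)
  /\
  (has_zero L0 -> has_zero L1 -> has_zero L2 ->
   preserves_zero eta1 -> preserves_zero eta2 ->
   exists (d : Order.disp_t) (L : latticeType d)
     (phi1 : {lmorphism L1 -> L}) (phi2 : {lmorphism L2 -> L}),
     [/\ congruence_amalgam eta1 eta2 psi1 psi2 phi1 phi2,
         has_zero L, preserves_zero phi1 & preserves_zero phi2])
  /\
  (finite_lattice L1 -> finite_lattice L2 ->
   exists (d : Order.disp_t) (L : latticeType d)
     (phi1 : {lmorphism L1 -> L}) (phi2 : {lmorphism L2 -> L}),
     [/\ congruence_amalgam eta1 eta2 psi1 psi2 phi1 phi2,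
         finite_lattice L & atomistic L]).
Proof.
have [d [L [phi1 [phi2 [am zs fin]]]]] :=
  amalgamation psi1_join psi2_join psi_eta.
split; first by exists d, L, phi1, phi2.
split=> [z0 _ _ e1 e2|fin1 fin2]; exists d, L, phi1, phi2; split=> //.
- by case: zs.
- by case: zs.
- by case: zs.
- by case: (fin fin1 fin2).
- by case: (fin fin1 fin2).
Qed.
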